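(* Let $q=p^{\alpha}$ be a prime power with $q\equiv 1\pmod 4$ and $p\neq 5$, and let $D=(P,B)$ and $G=\operatorname{PSL}(2,q)$ be as in the context. Then $D$ is a $\mathrm{GPBIBD}(m)$ with parameters $$v=\frac{q^2-1}{4},\quad b=\frac{q(q^2-1)}{24},\quad k=6,\quad r=q,\quad \lambda_1=4,\quad \lambda_2=1,\quad \lambda_3=\dots=\lambda_m=0,$$ whose underlying association scheme is the Schurian scheme $\mathcal{S}(G,P)$ of the action of $G$ on $P$, and the number of associate classes is $m=\frac{q-3}{2}$.
   Context: Let $\omega$ be a generator of $\mathbb{F}_q^{\times}$ and $i=\omega^{(q-1)/4}$. Let $P=(\mathbb{F}_q^2\setminus\{0\})/\langle i\rangle$ (nonzero column vectors with $\pi,-\pi,i\pi,-i\pi$ identified). $G=\operatorname{PSL}(2,q)=\operatorname{SL}(2,q)/\{\pm I\}$ acts on $P$ by multiplying representatives. Let $T\subseteq P$ be the set of classes of $\binom{1}{0},\binom{0}{1},\binom{1}{1},\binom{1+i}{1},\binom{i}{1},\binom{1}{1-i}$, $B=\{gT:g\in G\}$, and $D=(P,B)$ the incidence structure with points $P$ and blocks $B$. An association scheme with $m$ classes on a finite set $X$ is a partition of $X\times X$ into relations $R_0,\dots,R_m$ with $R_0=\{(x,x)\}$, each $R_j^{-1}$ again one of the relations, and such that for $(x,z)\in R_k$ the number of $y$ with $(x,y)\in R_i,(y,z)\in R_j$ depends only on $i,j,k$. The Schurian scheme $\mathcal{S}(G,P)$ has as relations the orbits of $G$ on $P\times P$.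 A $\mathrm{GPBIBD}(m)$ with parameters $v,b,k,r,\lambda_1,\dots,\lambda_m$ is a block design with $v$ points and $b$ blocks, each block of size $k$, each point on $r$ blocks, together with an association scheme (not necessarily symmetric) with classes $R_0,\dots,R_m$ on the point set such that for each $1\le j\le m$ any pair $(x,y)\in R_j$ lies together in exactly $\lambda_j$ blocks (for a suitable numbering of the non-identity classes). *)

(* Defs.v *)
From HB Require Import structures.
From mathcomp Require Import all_boot all_order all_algebra all_fingroup.

Set Implicit Arguments.
Unset Strict Implicit.
Unset Printing Implicit Defensive.

Import GRing.Theory.
Local Open Scope ring_scope.

Section Schemes.
Variable (T : finType).
Implicit Types (X : {set T}) (B : {set {set T}}).

(* [partition] makes the relations nonempty and pairwise disjoint as sets;    *)
(* with the injectivity of the numbering there are exactly m.+1 of them.      *)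
Record association_scheme X (m : nat) (R : 'I_m.+1 -> {set T * T}) : Prop :=
  AssociationScheme {
    as_partition : partition [set R j | j : 'I_m.+1] (setX X X);
    as_inj : injective R;
    as_diag : R ord0 = [set (x, x) | x in X];
    as_conv : forall j, exists j', [set (xy.2, xy.1) | xy in R j] = R j';
    as_inter : forall i j k, exists n : nat, forall x z, (x, z) \in R k ->
      #|[set y in X | ((x, y) \in R i) && ((y, z) \in R j)]| = n }.

(* The design is simple: its blocks form a set.  The value [lam 0] is unused. *)
Record GPBIBD X B (m : nat) (R : 'I_m.+1 -> {set T * T})
    (v b k r : nat) (lam : nat -> nat) : Prop := Gpbibd {
  gp_scheme : association_scheme X R;
  gp_blocks : forall A, A \in B -> A \subset X;
  gp_v : #|X| = v;
  gp_b : #|B| = b;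
  gp_k : forall A, A \in B -> #|A| = k;
  gp_r : forall x, x \in X -> #|[set A in B | x \in A]| = r;
  gp_lam : forall j : 'I_m.+1, (0 < j)%N -> forall x y, (x, y) \in R j ->
    #|[set A in B | (x \in A) && (y \in A)]| = lam j }.

(* [act] is a left action (the actions of [fingroup.action] are right ones).  *)
Definition schurian_relations (aT : finType) (act : aT -> T -> T)
    (G : {set aT}) X : {set {set T * T}} :=
  [set [set (act g xy.1, act g xy.2) | g in G] | xy in setX X X].

End Schemes.

Section PSL2.
Variable F : finFieldType.

Definition SL2 : {set {'GL_2[F]}} := [set g | \det (GLval g) == 1].

Fact SL2_group_set : group_set SL2.
Proof.
apply/group_setP; split; first by rewrite inE GL_1E det1.
move=> g h; rewrite !inE => /eqP dg /eqP dh.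
by rewrite GL_ME det_mulmx dg dh mulr1.
Qed.
Canonical SL2_group := Group SL2_group_set.

Definition pmI : {set {'GL_2[F]}} :=
  [set g | (GLval g == 1%:M) || (GLval g == - 1%:M)].

Fact pmI_group_set : group_set pmI.
Proof.
apply/group_setP; split; first by rewrite inE GL_1E eqxx.
move=> g h; rewrite !inE GL_ME.
by case/orP=> /eqP-> /orP[] /eqP->;
  rewrite -?mulmxE ?mulNmx ?mulmxN ?mul1mx ?opprK eqxx ?orbT.
Qed.
Canonical pmI_group := Group pmI_group_set.

Definition PSL2 : {set coset_of pmI} := (SL2 / pmI)%g.

Definition vec2 (a b : F) : 'cV[F]_2 := \col_j (if j == 0 then a else b).

(* A point is a class of nonzero vectors, i.e. a set of vectors. *)
Definition ptclass (u : {unit F}) (v : 'cV[F]_2) : {set 'cV[F]_2} :=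
  [set val c *: v | c in <[u]>%g].

Definition points (u : {unit F}) : {set {set 'cV[F]_2}} :=
  [set ptclass u v | v in [set v : 'cV[F]_2 | v != 0]].

(* All products of a representative of the coset and a representative of the  *)
(* class; when -1 is a power of u, the coset of g sends [ptclass u v] to      *)
(* [ptclass u (g v)].                                                         *)
Definition psl_act (g : coset_of pmI) (x : {set 'cV[F]_2}) : {set 'cV[F]_2} :=
  [set GLval h *m v | h in (g : {set {'GL_2[F]}}), v in x].

Definition base_block (u : {unit F}) : {set {set 'cV[F]_2}} :=
  let i : F := val u in
  [set ptclass u (vec2 1 0); ptclass u (vec2 0 1); ptclass u (vec2 1 1);
       ptclass u (vec2 (1 + i) 1); ptclass u (vec2 i 1);
       ptclass u (vec2 1 (1 - i))].

Definition blocks (u : {unit F}) : {set {set {set 'cV[F]_2}}} :=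
  [set [set psl_act g x | x in base_block u] | g in PSL2].

End PSL2.

(* Main.v *)
(* Let [u, v] be the determinant of two vectors.  As <i> consists of the fourth roots of
   unity, the orbits of G on P x P are the sets {[u,v]^4 = s} and {v = c u, c^4 = s}, for
   the (q-1)/4 nonzero fourth powers s.
   Among the six points of T, twelve pairs have [u,v]^4 = 1 and three disjoint pairs have
   [u,v]^4 = (1-i)^4 = -4: T is an octahedron whose edges and axes are these pairs, and
   1 <> -4 because p <> 5.  If u, v span an axis, the other vertices are
   (v + c u)/(1-i) with c^4 = 1, so the octahedron is determined by any one of its axes,
   and every pair in the orbit s = -4 is the axis of exactly one block.
   Hence lambda_2 = 1; the blocks through x correspond to the q antipodes of x (r = q);
   those containing an edge (u,v) have as antipode of u one of the four points
   (1-i) v - c u (lambda_1 = 4); and v r = 6 b gives b. *)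

Require Import Defs.
From mathcomp Require Import all_boot all_order all_algebra all_fingroup.
From mathcomp Require Import all_solvable all_field.
From mathcomp Require Import ring zify.

Set Implicit Arguments.
Unset Strict Implicit.
Unset Printing Implicit Defensive.

Import GRing.Theory.

Lemma card_imset_fibers (T U : finType) (f : T -> U) (A : {set T}) (k : nat) :
  {in A, forall x, #|[set y in A | f y == f x]| = k} ->
  #|A| = (#|f @: A| * k)%N.
Proof.
move=> fibk; rewrite -sum1_card (partition_big_imset f) -sum_nat_const.
apply: eq_bigr => _ /imsetP[x Ax ->]; rewrite -(fibk x Ax) -sum1_card.
by apply: eq_bigl => y; rewrite inE.
Qed.

(** * The scheme of orbits of a finite group on pairs *)

Section SchurianScheme.

Variables (T : finType) (aT : finGroupType) (act : aT -> T -> T).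
Variables (G : {group aT}) (X : {set T}).
Hypothesis act_closed : forall g x, g \in G -> x \in X -> act g x \in X.
Hypothesis act1 : forall x, x \in X -> act 1%g x = x.
Hypothesis actM : forall g h x, g \in G -> h \in G -> x \in X ->
  act (g * h)%g x = act g (act h x).

Lemma act_invK g x : g \in G -> x \in X -> act g^-1%g (act g x) = x.
Proof. by move=> Gg Xx; rewrite -actM ?groupV // mulVg act1. Qed.

Lemma act_inj g : g \in G -> {in X &, injective (act g)}.
Proof.
by move=> Gg x y Xx Xy /(congr1 (act g^-1%g)); rewrite !act_invK.
Qed.

Definition orbital (xy : T * T) : {set T * T} :=
  [set (act g xy.1, act g xy.2) | g in G].

Lemma mem_orbital x y : x \in X -> y \in X -> (x, y) \in orbital (x, y).
Proof. by move=> Xx Xy; apply/imsetP; exists 1%g; rewrite //= !act1. Qed.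

(** Orbitals are equivalence classes, so a relation can be rewritten as the orbital of any of its
    pairs. *)
Lemma orbital_sub x y z t : x \in X -> y \in X ->
  (z, t) \in orbital (x, y) -> [/\ z \in X, t \in X & orbital (z, t) = orbital (x, y)].
Proof.
move=> Xx Xy /imsetP[g Gg /= [-> ->]]; split; try exact: act_closed.
apply/setP=> ab; apply/imsetP/imsetP => /= -[h Gh ->].
  by exists (h * g)%g; rewrite ?groupM ?actM.
by exists (h * g^-1)%g; rewrite ?groupM ?groupV // !actM ?groupV ?act_closed ?act_invK.
Qed.

(** The group acts by bijections that preserve every relation, so the number of intermediate points
    is constant on an orbit of pairs. The numbering [R] is a parameter, which lets the design choose
    the relations that come first. *)
Theorem schurian_scheme m (R : 'I_m.+1 -> {set T * T}) :
    injective R -> [set R j | j : 'I_m.+1] = schurian_relations act G X ->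
    R ord0 = [set (x, x) | x in X] ->
  association_scheme X R.
Proof.
move=> Rinj RE R0.
have R_orb j : exists x y, [/\ x \in X, y \in X & R j = orbital (x, y)].
  have: R j \in schurian_relations act G X by rewrite -RE imset_f.
  by case/imsetP=> -[x y] /setXP[Xx Xy] ->; exists x, y.
have orb_R x y : x \in X -> y \in X -> exists j, orbital (x, y) = R j.
  move=> Xx Xy; suff: orbital (x, y) \in [set R j | j : 'I_m.+1].
    by case/imsetP=> j _ ->; exists j.
  by rewrite RE; apply/imsetP; exists (x, y); rewrite // inE /= Xx.
have R_mem j z t : (z, t) \in R j -> [/\ z \in X, t \in X & R j = orbital (z, t)].
  by have [x [y [Xx Xy ->]]] := R_orb j; case/(orbital_sub Xx Xy) => -> -> ->.
have R_act j g x y : g \in G -> (x, y) \in R j -> (act g x, act g y) \in R j.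
  by move=> Gg /R_mem[Xx Xy ->]; apply/imsetP; exists g.
split=> //.
- apply/and3P; split.
  + rewrite eqEsubset; apply/andP; split; apply/subsetP => -[x y].
      by case/bigcupP=> _ /imsetP[j _ ->] /R_mem[Xx Xy _]; rewrite inE /= Xx.
    case/setXP=> Xx Xy; have [j Ej] := orb_R x y Xx Xy.
    by apply/bigcupP; exists (R j); rewrite ?imset_f // -Ej mem_orbital.
  + apply/trivIsetP=> _ _ /imsetP[j _ ->] /imsetP[l _ ->].
    apply: contraR; case/pred0Pn=> -[x y] /andP[/= /R_mem[_ _ ->]].
    by case/R_mem=> _ _ ->.
  apply/imsetP=> -[j _ Ej].
  have [x [y [Xx Xy Rj]]] := R_orb j.
  by have := mem_orbital Xx Xy; rewrite -Rj -Ej inE.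
- move=> j; have [x [y [Xx Xy ->]]] := R_orb j.
  have [j' Ej'] := orb_R y x Xy Xx; exists j'; rewrite -Ej'.
  apply/setP=> ab; apply/imsetP/imsetP => /=.
    by case=> _ /imsetP[g Gg ->] ->; exists g.
  by case=> g Gg ->; exists (act g x, act g y); rewrite // imset_f.
move=> i j k; have [x0 [z0 [Xx0 Xz0 Rk]]] := R_orb k.
pose S x z := [set y in X | ((x, y) \in R i) && ((y, z) \in R j)].
(* An inequality for every g suffices: for the inverse of g it gives the reverse one. *)
have leS g x z : g \in G -> (#|S x z| <= #|S (act g x) (act g z)|)%N.
  move=> Gg; rewrite -(@card_in_imset _ _ (act g) (S x z)); last first.
    by move=> y y'; rewrite !inE => /andP[Xy _] /andP[Xy' _]; apply: act_inj.
  apply/subset_leq_card/subsetP=> _ /imsetP[y Sy ->].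
  move: Sy; rewrite !inE => /and3P[Xy Ri Rj].
  by rewrite act_closed //= !R_act.
exists #|S x0 z0| => x z; rewrite Rk => /imsetP[g Gg /= [-> ->]].
apply/eqP; rewrite eqn_leq leS // andbT.
by have := leS g^-1%g (act g x0) (act g z0); rewrite groupV !act_invK //; apply.
Qed.

End SchurianScheme.

(** * Determinants of pairs of vectors *)

Section Plane.

Local Open Scope ring_scope.

Variable F : finFieldType.
Implicit Types (u v : 'cV[F]_2) (c d s t : F).

(** The determinant of the matrix with columns [u] and [v], in coordinates so that [ring] and
    [field] prove its identities. *)
Definition cross u v : F := u 0 0 * v 1 0 - u 1 0 * v 0 0.

Lemma col2P u v : u 0 0 = v 0 0 -> u 1 0 = v 1 0 -> u = v.
Proof.
move=> e0 e1; apply/matrixP => j k; rewrite ord1 {k}.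
case: j => [[|[|j]] lt2] //.
  by rewrite (_ : Ordinal lt2 = 0) //; apply: val_inj.
by rewrite (_ : Ordinal lt2 = 1) //; apply: val_inj.
Qed.

Lemma col2_neq0 u : u != 0 -> (u 0 0 != 0) || (u 1 0 != 0).
Proof.
rewrite -negb_and; apply: contra => /andP[/eqP e0 /eqP e1].
by apply/eqP/col2P; rewrite mxE.
Qed.

Lemma det_mx22 (A : 'M[F]_2) : \det A = A 0 0 * A 1 1 - A 0 1 * A 1 0.
Proof.
have l0 : lift (0 : 'I_2) (0 : 'I_1) = 1 by apply: val_inj.
have l1 : lift (1 : 'I_2) (0 : 'I_1) = 0 by apply: val_inj.
rewrite (expand_det_row _ 0) !big_ord_recl big_ord0 /cofactor !det_mx11 !mxE.
by rewrite l0 l1 expr0 expr1 mul1r mulN1r mulrN addr0.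
Qed.

(** The type ['M_(1 + 1)] makes [row_mx u v] square; multiplicativity of the determinant then
    carries over to [cross]. *)
Lemma det_row_mx u v : \det (row_mx u v : 'M_(1 + 1)) = cross u v.
Proof.
have El k : (row_mx u v : 'M_(2, 1 + 1)) k 0 = u k 0.
  by rewrite -(row_mxEl u v); congr (row_mx _ _ _ _); apply: val_inj.
have Er k : (row_mx u v : 'M_(2, 1 + 1)) k 1 = v k 0.
  by rewrite -(row_mxEr u v); congr (row_mx _ _ _ _); apply: val_inj.
by rewrite det_mx22 !El !Er /cross (mulrC (v _ _)).
Qed.

Lemma crossZl c u v : cross (c *: u) v = c * cross u v.
Proof. by rewrite /cross !mxE; ring. Qed.

Lemma crossZr c u v : cross u (c *: v) = c * cross u v.
Proof. by rewrite /cross !mxE; ring. Qed.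

Lemma crossDr u v v' : cross u (v + v') = cross u v + cross u v'.
Proof. by rewrite /cross !mxE; ring. Qed.

Lemma crossvv u : cross u u = 0.
Proof. by rewrite /cross; ring. Qed.

Lemma crossC u v : cross v u = - cross u v.
Proof. by rewrite /cross; ring. Qed.

Lemma cross0l v : cross 0 v = 0.
Proof. by rewrite /cross !mxE; ring. Qed.

Lemma cross_neq0l u v : cross u v != 0 -> u != 0.
Proof. by apply: contraNneq => ->; rewrite cross0l. Qed.

Lemma cross_neq0r u v : cross u v != 0 -> v != 0.
Proof. by rewrite -oppr_eq0 -crossC; apply: cross_neq0l. Qed.

Lemma cross_eq0_colinear u v : u != 0 -> cross u v = 0 -> exists c, v = c *: u.
Proof.
case/col2_neq0/orP=> un0 /eqP; rewrite subr_eq0 => /eqP uv.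
  exists (v 0 0 / u 0 0); apply: col2P; rewrite !mxE ?divfK //.
  by apply: (mulfI un0); rewrite uv; field.
exists (v 1 0 / u 1 0); apply: col2P; rewrite !mxE ?divfK //.
by apply: (mulfI un0); rewrite -uv; field.
Qed.

Lemma cross_solve u d : u != 0 -> exists v, cross u v = d.
Proof.
case/col2_neq0/orP=> un0.
  by exists (vec2 0 (d / u 0 0)); rewrite /cross !mxE /=; field.
by exists (vec2 (- (d / u 1 0)) 0); rewrite /cross !mxE /=; field.
Qed.

(** The matrix taking the basis [u], [v] to [u'], [v'] has as determinant the quotient of the two
    values of [cross], here 1. *)
Lemma SL2_trans u v u' v' : cross u v != 0 -> cross u' v' = cross u v ->
  exists2 h, h \in SL2 F & GLval h *m u = u' /\ GLval h *m v = v'.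
Proof.
pose M a b : 'M[F]_(1 + 1) := row_mx a b.
move=> d_neq0 Ed.
have UM : M u v \in unitmx by rewrite unitmxE det_row_mx unitfE.
pose A := M u' v' *m invmx (M u v).
have dA : \det A = 1 by rewrite det_mulmx det_inv !det_row_mx Ed divff.
have UA : A \is a GRing.unit by rewrite unitmxE dA unitr1.
exists (FinRing.Unit UA); first by rewrite inE; apply/eqP.
have : A *m M u v = M u' v' by rewrite mulmxKV.
by rewrite /M mul_mx_row => /eq_row_mx.
Qed.

Lemma cross_mulmx (A : 'M[F]_2) u v : cross (A *m u) (A *m v) = \det A * cross u v.
Proof. by rewrite -!det_row_mx -mul_mx_row det_mulmx. Qed.

End Plane.

(** * Fourth roots of unity and classes of vectors *)

Section Design.

Local Open Scope ring_scope.

Variables (F : finFieldType) (iu : {unit F}).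
Implicit Types (u v : 'cV[F]_2) (c d s t : F) (x y z : {set 'cV[F]_2}).
Let i : F := val iu.
Hypothesis i2 : i ^+ 2 = -1.
Hypothesis two_neq0 : (2%:R : F) != 0.

Lemma i4 : i ^+ 4 = 1.
Proof. by ring: i2. Qed.

(** c^4 - 1 splits into the four linear factors c - i^k. *)
Lemma pow4_eq1P c : reflect (exists k : 'I_4, c = i ^+ k) (c ^+ 4 == 1).
Proof.
apply: (iffP eqP) => [c4|[k ->]]; last by rewrite exprAC i4 expr1n.
have : (c - i ^+ 0) * (c - i ^+ 1) * (c - i ^+ 2) * (c - i ^+ 3) = 0 by ring: i2 c4.
move/eqP; rewrite !mulf_eq0 !subr_eq0 -!orbA.
by case/or4P=> /eqP->; [exists 0 | exists 1 | exists 2 | exists 3].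
Qed.

Lemma pow4_neq0 c : c ^+ 4 = 1 -> c != 0.
Proof. by apply: contra_eq_neq => ->; rewrite expr0n /= eq_sym oner_eq0. Qed.

Local Notation pt := (ptclass iu).

(** The powers of i are exactly the fourth roots of unity, so membership in a class becomes an
    equation free of cyclic groups. *)
Lemma mem_pt u v : (v \in pt u) = [exists c, (c ^+ 4 == 1) && (v == c *: u)].
Proof.
apply/imsetP/existsP => [[_ /cycleP[k ->] ->]|[c /andP[/pow4_eq1P[k ->] /eqP->]]].
  by exists (i ^+ k); rewrite exprAC i4 expr1n eqxx /= FinRing.val_unitX.
by exists (iu ^+ k)%g; rewrite ?mem_cycle // FinRing.val_unitX.
Qed.

Lemma pt_refl v : v \in pt v.
Proof. by rewrite mem_pt; apply/existsP; exists 1; rewrite expr1n scale1r !eqxx. Qed.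

Lemma pt_eqP u v : reflect (exists2 c, c ^+ 4 = 1 & v = c *: u) (pt u == pt v).
Proof.
apply: (iffP eqP) => [E|[c c4 ->]].
  have := pt_refl v; rewrite -E mem_pt => /existsP[c /andP[/eqP c4 /eqP->]].
  by exists c.
have c0 := pow4_neq0 c4; apply/setP=> w; rewrite !mem_pt.
apply/existsP/existsP => -[d /andP[/eqP d4 /eqP->]].
  by exists (d / c); rewrite scalerA divfK // expr_div_n c4 d4 divr1 !eqxx.
by exists (d * c); rewrite scalerA exprMn c4 d4 mulr1 !eqxx.
Qed.

Lemma ptZ c v : c ^+ 4 = 1 -> pt (c *: v) = pt v.
Proof. by move=> c4; apply/esym/eqP/pt_eqP; exists c. Qed.

Lemma pt_cross_eq0 u v : pt u = pt v -> cross u v = 0.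
Proof. by move/eqP/pt_eqP=> [c _ ->]; rewrite crossZr crossvv mulr0. Qed.

(** Changing representatives multiplies [cross] by fourth roots of unity, so its fourth power is an
    invariant of pairs of points. *)
Lemma pt_cross4 u v u' v' : pt u = pt u' -> pt v = pt v' ->
  cross u v ^+ 4 = cross u' v' ^+ 4.
Proof.
move=> /eqP/pt_eqP[c c4 ->] /eqP/pt_eqP[d d4 ->].
by rewrite crossZl crossZr !exprMn c4 d4 !mul1r.
Qed.

Lemma mem_points v : (pt v \in points iu) = (v != 0).
Proof.
apply/imsetP/idP => [[w]|v0]; last by exists v; rewrite ?inE.
rewrite inE => w0 /eqP/pt_eqP[c c4 Ew]; apply: contraNneq w0 => v0.
by rewrite Ew v0 scaler0.
Qed.

Lemma pointsP x : reflect (exists2 v, v != 0 & x = pt v) (x \in points iu).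
Proof.
apply: (iffP imsetP) => [[v]|[v v0 ->]]; last by exists v; rewrite ?inE.
by rewrite inE => v0 ->; exists v.
Qed.

(** * Counting points and fourth powers *)

Lemma card_pow4_eq1 : #|[set c : F | c ^+ 4 == 1]| = 4%N.
Proof.
(* If i, i^2 or i^3 were 1, then 2 would vanish. *)
have i_neq1 : i - 1 != 0.
  apply: contraNneq two_neq0 => i1.
  by have -> : 2%:R = - (i - 1) * (i + 1) by [ring: i2]; rewrite i1 oppr0 mul0r.
have i2_neq1 : i ^+ 2 - 1 != 0.
  by rewrite i2 -opprD oppr_eq0.
have i3_neq1 : i ^+ 3 - 1 != 0.
  apply: contraNneq two_neq0 => i1.
  by have -> : 2%:R = - (i ^+ 3 - 1) * (i ^+ 3 + 1) by [ring: i2]; rewrite i1 oppr0 mul0r.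
have i0 : i != 0 by apply/pow4_neq0/i4.
have i_inj : injective (fun k : 'I_4 => i ^+ k).
  (* For k < l, i^l - i^k = (i^(l-k) - 1) i^k with 0 < l - k < 4. *)
  suff lt_inj (k l : 'I_4) : (k < l)%N -> i ^+ k != i ^+ l.
    move=> k l Ekl; apply: val_inj; case: (ltngtP k l) => // /lt_inj; by rewrite Ekl eqxx.
  move=> ltkl; rewrite eq_sym -(subnK (ltnW ltkl)) exprD -subr_eq0.
  rewrite -[X in _ - X]mul1r -mulrBl.
  rewrite mulf_neq0 ?expf_neq0 //.
  have : (0 < l - k < 4)%N by have := ltn_ord l; lia.
  by case: (l - k)%N => [|[|[|[|]]]].
rewrite -[RHS]card_ord -(card_imset _ i_inj); apply: eq_card => c.
rewrite inE; apply/pow4_eq1P/imsetP => [[k ->]|[k _ ->]]; by exists k.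
Qed.

Lemma card_fiber_pow4 (a : F) : a != 0 -> #|[set b | b ^+ 4 == a ^+ 4]| = 4%N.
Proof.
move=> a0; rewrite -[RHS]card_pow4_eq1.
rewrite -[RHS](card_imset _ (mulIf a0)); apply: eq_card => b; rewrite inE.
apply/eqP/imsetP => [E|[c]].
  by exists (b / a); rewrite ?divfK // inE expr_div_n E divff ?expf_neq0.
by rewrite inE => /eqP c4 ->; rewrite exprMn c4 mul1r.
Qed.

(** The fourth roots of unity act freely on nonzero vectors, so each point has four
    representatives. *)
Lemma card_points : (#|points iu| * 4 = #|F| ^ 2 - 1)%N.
Proof.
have -> : (#|F| ^ 2 - 1 = #|[set v : 'cV[F]_2 | v != 0%R]|)%N.
  have := cardsC1 (0 : 'cV[F]_2); rewrite card_mx muln1 subn1 => <-.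
  by apply: eq_card => v; rewrite !inE.
rewrite (@card_imset_fibers _ _ pt  _ 4%N) // => v; rewrite inE => v0.
rewrite -[RHS]card_pow4_eq1.
have Zinj : injective (fun c => c *: v).
  move=> c d /eqP; rewrite -subr_eq0 -scalerBl scaler_eq0 (negPf v0) orbF subr_eq0.
  by move/eqP.
rewrite -[RHS](card_imset _ Zinj); apply: eq_card => w; rewrite !inE [_ == pt v]eq_sym.
apply/andP/imsetP => [[w0 /pt_eqP[c c4 ->]]|[c]].
  by exists c; rewrite ?inE ?c4 ?eqxx.
rewrite inE => /eqP c4 ->; split; last by apply/pt_eqP; exists c.
by rewrite scaler_eq0 negb_or pow4_neq0.
Qed.

Definition fourth_powers : {set F} := [set c ^+ 4 | c in [set c : F | c != 0]].

Lemma card_fourth_powers : (#|fourth_powers| * 4 = #|F| - 1)%N.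
Proof.
have -> : (#|F| - 1 = #|[set c : F | c != 0%R]|)%N.
  by rewrite subn1 -(cardsC1 (0 : F)); apply: eq_card => v; rewrite !inE.
apply/esym/card_imset_fibers => a; rewrite inE => a0.
rewrite -[RHS](card_fiber_pow4 a0); apply: eq_card => b; rewrite !inE.
rewrite andb_idl //; apply: contraTneq => ->.
by rewrite expr0n /= eq_sym expf_neq0.
Qed.

(** * The action of PSL(2,q) on points *)

(** I and -I are central; as every matrix normalises [pmI], [coset] can be computed on the whole of
    GL(2,q). *)
Lemma pmI_norm (h : {'GL_2[F]}) : h \in 'N(pmI F)%g.
Proof.
apply: (subsetP (cent_sub _)); apply/centP=> g; rewrite inE.
move=> pm_g; apply/val_inj; change (GLval (h * g) = GLval (g * h)).
by rewrite !GL_MxE; case/orP: pm_g => /eqP->; rewrite ?mulNmx ?mulmxN mulmx1 mul1mx.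
Qed.

(** A representative of the coset is h or -h, and the class absorbs the sign because (-1)^4 = 1. The
    action thus reduces to products of matrices and vectors. *)
Lemma psl_act_pt (h : {'GL_2[F]}) v :
  psl_act (coset (pmI F) h) (pt v) = pt (GLval h *m v).
Proof.
rewrite /psl_act val_coset ?pmI_norm //.
apply/setP=> w; apply/imset2P/idP.
  case=> g v'; rewrite mem_rcoset inE => hg.
  rewrite !mem_pt => /existsP[c /andP[c4 /eqP->]] ->.
  have : GLval g = GLval h \/ GLval g = - GLval h.
    have Eg : GLval g = GLval (g * h^-1)%g *m GLval h by rewrite -GL_MxE mulgKV.
    move: (GLval (g * h^-1)%g) Eg hg => k -> /orP[] /eqP ->; [left | right].
      by rewrite mul1mx.
    by rewrite mulNmx mul1mx.
  case=> ->; apply/existsP; [exists c | exists (- c)].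
    by rewrite c4 scalemxAr eqxx.
  by rewrite mulNmx -scalemxAr scaleNr eqxx exprNn -signr_odd expr0 mul1r c4.
rewrite mem_pt => /existsP[c /andP[c4 /eqP->]].
exists h (c *: v); rewrite ?rcoset_refl ?scalemxAr //.
by rewrite mem_pt; apply/existsP; exists c; rewrite c4 eqxx.
Qed.

Lemma psl_act_closed g x : g \in PSL2 F -> x \in points iu -> psl_act g x \in points iu.
Proof.
case/morphimP=> h _ SLh -> /pointsP[v v0 ->]; rewrite psl_act_pt mem_points.
apply: contraNneq v0 => hv0; have := mulKmx (GL_unitmx h) v.
by rewrite hv0 mulmx0 => <-.
Qed.

Lemma psl_act1 x : x \in points iu -> psl_act 1%g x = x.
Proof.
case/pointsP=> v _ ->; rewrite -(morph1 (coset_morphism (pmI F))) psl_act_pt.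
by rewrite GL_1E mul1mx.
Qed.

Lemma psl_actM g g' x : g \in PSL2 F -> g' \in PSL2 F -> x \in points iu ->
  psl_act (g * g')%g x = psl_act g (psl_act g' x).
Proof.
case/morphimP=> h Nh _ -> /morphimP[h' Nh' _ ->] /pointsP[v _ ->].
by rewrite -morphM // !psl_act_pt GL_ME mulmxA.
Qed.

Lemma PSL2P g : reflect (exists2 h, h \in SL2 F & g = coset (pmI F) h) (g \in PSL2 F).
Proof.
apply: (iffP morphimP) => [[h _ SLh ->]|[h SLh ->]]; first by exists h.
by exists h; rewrite ?pmI_norm.
Qed.

(** * Orbits on pairs of points *)

(** The ratio of proportional representatives is defined only up to a fourth root of unity, hence
    the index is its fourth power. *)
Definition line_orbital s : {set {set 'cV[F]_2} * {set 'cV[F]_2}} :=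
  [set (pt vc.1, pt (vc.2 *: vc.1)) | vc : 'cV[F]_2 * F in
     [set vc | (vc.1 != 0) && (vc.2 ^+ 4 == s)]].

Definition cross_orbital s : {set {set 'cV[F]_2} * {set 'cV[F]_2}} :=
  [set (pt uv.1, pt uv.2) | uv in
     [set uv : 'cV[F]_2 * 'cV[F]_2 | cross uv.1 uv.2 ^+ 4 == s]].

Lemma mem_cross_orbital s u v :
  ((pt u, pt v) \in cross_orbital s) = (cross u v ^+ 4 == s).
Proof.
apply/imsetP/idP => [[[u' v']]|uvs]; last by exists (u, v); rewrite ?inE.
by rewrite inE /= => /eqP <- [] /pt_cross4 E /E ->.
Qed.

(** [PSL2] appears here with its group structure, as [orbital] requires. *)
Local Notation orb := (orbital (@psl_act F) (SL2_group F / pmI_group F)%G).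

Lemma orbital_ptP u v x y :
  reflect (exists2 h, h \in SL2 F & x = pt (GLval h *m u) /\ y = pt (GLval h *m v))
          ((x, y) \in orb (pt u, pt v)).
Proof.
apply: (iffP imsetP) => [[_ /PSL2P[h SLh ->] /= [-> ->]]|[h SLh [-> ->]]].
  by exists h; rewrite ?psl_act_pt.
by exists (coset (pmI F) h); [apply/PSL2P; exists h | rewrite /= !psl_act_pt].
Qed.

(** When the fourth powers of [cross] agree, scaling one vector by a fourth root of unity makes the
    determinants equal, and [SL2_trans] applies. *)
Lemma orbital_cross u v : cross u v != 0 ->
  orb (pt u, pt v) = cross_orbital (cross u v ^+ 4).
Proof.
move=> uv0; apply/setP=> -[x y]; apply/orbital_ptP/imsetP.
  case=> h; rewrite inE => /eqP dh [-> ->].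
  by exists (GLval h *m u, GLval h *m v); rewrite // inE /= cross_mulmx dh mul1r.
case=> -[u' v']; rewrite inE /= => /eqP E [-> ->].
pose c := cross u v / cross u' v'.
have u'v'0 : cross u' v' != 0.
  by apply: contraNneq uv0 => e0; have /eqP := E; rewrite e0 expr0n eq_sym expf_eq0.
have c4 : c ^+ 4 = 1 by rewrite expr_div_n -E divff ?expf_neq0.
have [|h SLh [hu hv]] := @SL2_trans _ u v u' (c *: v') uv0.
  by rewrite crossZr divfK.
by exists h; rewrite // hu hv ptZ.
Qed.

(** Since [SL2_trans] moves bases, v and v' are each completed to one of determinant 1. *)
Lemma orbital_line c v : v != 0 -> orb (pt v, pt (c *: v)) = line_orbital (c ^+ 4).
Proof.
move=> v0; apply/setP=> -[x y]; apply/orbital_ptP/imsetP.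
  case=> h SLh [-> ->]; exists (GLval h *m v, c); rewrite ?scalemxAr // inE /= eqxx andbT.
  apply: contraNneq v0 => hv0; have := mulKmx (GL_unitmx h) v.
  by rewrite hv0 mulmx0 => <-.
case=> -[v' d]; rewrite inE /= => /andP[v'0 /eqP E] [-> ->].
have [t vt] := cross_solve 1 v0; have [t' vt'] := cross_solve 1 v'0.
have [||h SLh [hu hv]] := @SL2_trans _ v t v' t'; rewrite ?vt ?oner_eq0 //.
exists h; rewrite // -scalemxAr hu; split=> //.
(* As c^4 = d^4, the required root of unity is c / d, unless c and d both vanish. *)
apply/eqP/pt_eqP.
have [c0|c0] := eqVneq c 0.
  move: E; rewrite c0 expr0n /= => /eqP; rewrite expf_eq0 /= => /eqP ->.
  by exists 1; rewrite ?expr1n // !scale0r scaler0.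
have d0 : d != 0.
  by apply: contraNneq c0 => d0; have /eqP := E; rewrite d0 expr0n eq_sym expf_eq0.
exists (c / d); first by rewrite expr_div_n E divff ?expf_neq0.
by rewrite scalerA divfK.
Qed.
Lemma mem_line_orbital s c v : v != 0 ->
  ((pt v, pt (c *: v)) \in line_orbital s) = (c ^+ 4 == s).
Proof.
move=> v0; apply/imsetP/idP => [[[v' d]]|cs]; last first.
  by exists (v, c); rewrite // inE /= v0.
rewrite inE /= => /andP[v'0 /eqP <-] [/eqP/pt_eqP[a a4 ->] /eqP/pt_eqP[b b4]].
move/eqP; rewrite -subr_eq0 !scalerA -scalerBl scaler_eq0 (negPf v0) orbF subr_eq0.
move/eqP/(congr1 (fun e => e ^+ 4)); rewrite !exprMn a4 b4 mulr1 mul1r => ->.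
exact: eqxx.
Qed.

Lemma line_orbital1 : line_orbital 1 = [set (x, x) | x in points iu].
Proof.
apply/setP=> xy; apply/imsetP/imsetP => [[[v c]]|[_ /pointsP[v v0 ->] ->]].
  rewrite inE /= => /andP[v0 /eqP c4] ->.
  by exists (pt v); rewrite ?mem_points ?ptZ.
by exists (v, 1); rewrite ?scale1r // inE /= v0 expr1n eqxx.
Qed.

Lemma fourth_powersP s : reflect (exists2 c, c != 0 & s = c ^+ 4) (s \in fourth_powers).
Proof.
apply: (iffP imsetP) => [[c]|[c c0 ->]]; last by exists c; rewrite ?inE.
by rewrite inE => c0 ->; exists c.
Qed.

Lemma e1_neq0 : vec2 1 0 != 0 :> 'cV[F]_2.
Proof. by apply/eqP => /colP/(_ 0)/eqP; rewrite !mxE oner_eq0. Qed.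

(** Representatives of two points are either independent or proportional; conversely, each relation
    contains a pair starting at the first basis vector. *)
Lemma schurian_relationsE :
  schurian_relations (@psl_act F) (PSL2 F) (points iu)
  = [set cross_orbital s | s in fourth_powers]
    :|: [set line_orbital s | s in fourth_powers].
Proof.
apply/setP=> R; rewrite inE; apply/imsetP/orP.
  case=> -[_ _] /setXP[/pointsP[u u0 ->] /pointsP[v v0 ->]] ->.
  rewrite -[X in X \in _]/(orb (pt u, pt v)) -[X in _ \/ X \in _]/(orb (pt u, pt v)).
  have [uv0|uv0] := eqVneq (cross u v) 0; [right | left].
    have [c Ev] := cross_eq0_colinear u0 uv0; rewrite Ev orbital_line //.
    apply/imset_f/fourth_powersP; exists c => //.
    by apply: contraNneq v0; rewrite Ev => ->; rewrite scale0r.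
  by rewrite orbital_cross //; apply/imset_f/fourth_powersP; exists (cross u v).
case=> /imsetP[_ /fourth_powersP[c c0 ->] ->].
  have [v uv] := cross_solve c e1_neq0.
  exists (pt (vec2 1 0), pt v); last by rewrite -uv -orbital_cross ?uv.
  by rewrite inE /= !mem_points e1_neq0 (@cross_neq0r _ (vec2 1 0)) ?uv.
exists (pt (vec2 1 0), pt (c *: vec2 1 0)); last exact/esym/orbital_line/e1_neq0.
by rewrite inE /= !mem_points scaler_eq0 negb_or c0 e1_neq0.
Qed.

(** Every nonzero fourth power is attained by some pair, so the relation is nonempty and recovers
    its index. *)
Lemma cross_orbital_inj : {in fourth_powers, injective cross_orbital}.
Proof.
move=> _ /fourth_powersP[c c0 ->] s E.
have [v uv] := cross_solve c e1_neq0.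
have := mem_cross_orbital s (vec2 1 0) v.
by rewrite -E mem_cross_orbital uv eqxx => /esym/eqP.
Qed.

Lemma line_orbital_inj : {in fourth_powers, injective line_orbital}.
Proof.
move=> _ /fourth_powersP[c c0 ->] s E.
have := mem_line_orbital s c e1_neq0.
by rewrite -E mem_line_orbital ?e1_neq0 // eqxx => /esym/eqP.
Qed.

(** Proportional vectors have [cross] 0, which is not the fourth power of a nonzero scalar. *)
Lemma cross_line_orbital_neq s t : s \in fourth_powers -> t \in fourth_powers ->
  cross_orbital s != line_orbital t.
Proof.
case/fourth_powersP=> d d0 Es /fourth_powersP[c c0 Et].
apply/eqP=> E; have := mem_line_orbital t c e1_neq0.
rewrite -E mem_cross_orbital crossZr crossvv mulr0 expr0n /= Es Et eqxx => /eqP.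
by apply/eqP; rewrite eq_sym expf_neq0.
Qed.

(** The two families are disjoint and have (q-1)/4 relations each. *)
Lemma card_schurian_relations :
  (#|schurian_relations (@psl_act F) (PSL2 F) (points iu)| * 2 = #|F| - 1)%N.
Proof.
rewrite schurian_relationsE cardsU (_ : _ :&: _ = set0) ?cards0 ?subn0; last first.
  apply/setP=> R; rewrite !inE; apply/andP=> -[/imsetP[s fs ->] /imsetP[t ft]].
  by apply/eqP; apply: cross_line_orbital_neq.
rewrite (card_in_imset (f := cross_orbital)); last first.
  by move=> s t fs _; apply: cross_orbital_inj.
rewrite (card_in_imset (f := line_orbital)); last first.
  by move=> s t fs _; apply: line_orbital_inj.
by have := card_fourth_powers; lia.
Qed.

(** * Octahedra, their axes and their edges *)

(* Used when cross u v ^+ 4 = -4: then [pt u] and [pt v] are antipodal vertices. *)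
Definition octahedron u v : {set {set 'cV[F]_2}} :=
  pt u |: (pt v |: [set pt ((1 - i)^-1 *: (v + c *: u)) | c in [set c | c ^+ 4 == 1]]).

Lemma one_minus_i_neq0 : 1 - i != 0.
Proof.
apply: contraNneq two_neq0 => e0.
by have -> : 2%:R = (1 - i) * (1 + i) by [ring: i2]; rewrite e0 mul0r.
Qed.
Let i1 := one_minus_i_neq0.

Lemma four_neq0 : (-4%:R : F) != 0.
Proof.
by have -> : -4%:R = - (2%:R * 2%:R) :> F by [ring]; rewrite oppr_eq0 mulf_neq0.
Qed.

Lemma one_minus_i4 : (1 - i) ^+ 4 = -4%:R.
Proof. by ring: i2. Qed.

Hypothesis five_neq0 : (5%:R : F) != 0.

(** The difference is 5. This keeps the edges and the axes of an octahedron in different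
    orbitals. *)
Lemma one_neq_m4 : (1 : F) != -4%:R.
Proof. by rewrite -subr_eq0 (_ : 1 - _ = 5%:R) //; ring. Qed.

Lemma octahedronP u v x :
  reflect [\/ x = pt u, x = pt v |
             exists2 c, c ^+ 4 = 1 & x = pt ((1 - i)^-1 *: (v + c *: u))]
          (x \in octahedron u v).
Proof.
rewrite /octahedron !in_setU1; apply: (iffP or3P) => -[].
- by move/eqP; constructor 1.
- by move/eqP; constructor 2.
- by case/imsetP=> c; rewrite inE => /eqP c4 ->; constructor 3; exists c.
- by move/eqP; constructor 1.
- by move/eqP; constructor 2.
by case=> c c4 ->; constructor 3; apply/imsetP; exists c; rewrite ?inE ?c4.
Qed.

Lemma octahedron_fst u v : pt u \in octahedron u v.
Proof. by apply/octahedronP; constructor 1. Qed.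

Lemma octahedron_snd u v : pt v \in octahedron u v.
Proof. by apply/octahedronP; constructor 2. Qed.

(** If u1 = a u2 and v1 = b v2, then v1 + c u1 = b (v2 + (c a / b) u2), and c a / b is again a
    fourth root of unity. *)
Lemma eq_octahedron u v u' v' : pt u = pt u' -> pt v = pt v' ->
  octahedron u v = octahedron u' v'.
Proof.
have sub u1 v1 u2 v2 : pt u1 = pt u2 -> pt v1 = pt v2 ->
    octahedron u1 v1 \subset octahedron u2 v2.
  move=> Eu Ev; apply/subsetP => x /octahedronP[->|->|].
  - by rewrite Eu octahedron_fst.
  - by rewrite Ev octahedron_snd.
  case=> c c4 ->; apply/octahedronP; constructor 3.
  have /eqP/pt_eqP[a a4 ->] := esym Eu; have /eqP/pt_eqP[b b4 ->] := esym Ev.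
  exists (c * a / b); first by rewrite expr_div_n exprMn a4 b4 c4 divr1 mulr1.
  rewrite -[RHS](ptZ _ b4); congr pt.
  by apply: col2P; rewrite !mxE; field; rewrite pow4_neq0 ?i1.
by move=> Eu Ev; apply/eqP; rewrite eqEsubset !sub.
Qed.

(** The identity u + c v = c (v + c^-1 u) matches the parameters c and c^-1. *)
Lemma octahedronC u v : octahedron v u = octahedron u v.
Proof.
have sub u1 v1 : octahedron v1 u1 \subset octahedron u1 v1.
  apply/subsetP => x /octahedronP[->|->|]; rewrite ?octahedron_fst ?octahedron_snd //.
  case=> c c4 ->; apply/octahedronP; constructor 3.
  exists c^-1; first by rewrite exprVn c4 invr1.
  rewrite -[RHS](ptZ _ c4); congr pt.
  by apply: col2P; rewrite !mxE; field; rewrite pow4_neq0 ?i1.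
by apply/eqP; rewrite eqEsubset !sub.
Qed.

(* The other two antipodal pairs reduce to this one by scaling u by a power of i. *)
Lemma octahedron_rot u v :
  octahedron ((1 - i)^-1 *: (v + u)) ((1 - i)^-1 *: (v - u)) = octahedron u v.
Proof.
have sub u1 v1 :
    octahedron ((1 - i)^-1 *: (v1 + u1)) ((1 - i)^-1 *: (v1 - u1))
    \subset octahedron u1 v1.
  apply/subsetP => x /octahedronP[->|->|].
  - apply/octahedronP; constructor 3; exists 1; rewrite ?expr1n //.
    by rewrite scale1r.
  - apply/octahedronP; constructor 3; exists (-1); first by ring.
    by rewrite scaleN1r.
  (* For c = 1, i, -1, -i these vertices are, in the octahedron of u1 and v1: v1, the vertex of
     parameter i, u1, the vertex of parameter -i. *)
  case=> c c4 ->; have /pow4_eq1P[k ->] : c ^+ 4 == 1 by rewrite c4.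
  apply/octahedronP.
  case: k => -[|[|[|[|k]]]] //= _.
  - constructor 2; rewrite -(ptZ v1 i4); congr pt.
    by apply: col2P; rewrite !mxE; field: i2.
  - constructor 3; exists i; first exact: i4.
    rewrite -[RHS](ptZ _ i4); congr pt.
    by apply: col2P; rewrite !mxE; field: i2.
  - constructor 1; rewrite -[RHS](@ptZ (- i)); last by rewrite -i4; ring.
    congr pt.
    by apply: col2P; rewrite !mxE; field: i2.
  - constructor 3; exists (- i); first by rewrite -i4; ring.
    congr pt.
    by apply: col2P; rewrite !mxE; field: i2.
(* Since (1-i)^2 = -2i, two rotations take (u, v) to (i v, -i u), which gives the same octahedron;
   the inclusion for the rotated pair is therefore the reverse one. *)
apply/eqP; rewrite eqEsubset sub /=.
set u' := _ *: (v + u); set v' := _ *: (v - u).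
suff <- : octahedron ((1 - i)^-1 *: (v' + u')) ((1 - i)^-1 *: (v' - u')) = octahedron u v.
  exact: sub.
rewrite -[RHS]octahedronC; apply: eq_octahedron.
  rewrite -[RHS](ptZ _ i4); congr pt.
  by apply: col2P; rewrite !mxE; field: i2.
rewrite -[RHS](@ptZ (- i)); last by rewrite -i4; ring.
congr pt.
by apply: col2P; rewrite !mxE; field: i2.
Qed.

(** Every vertex is an end of an axis: opposite to v + c u lies v - c u, and after division of both
    by 1 - i their [cross] is i c times that of u and v. *)
Lemma octahedron_at_fst u v x : cross u v ^+ 4 = -4%:R -> x \in octahedron u v ->
  exists u' v', [/\ x = pt u', cross u' v' ^+ 4 = -4%:R
                  & octahedron u v = octahedron u' v'].
Proof.
move=> uv /octahedronP[->|->|]; first by exists u, v.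
  exists v, u; split=> //; last exact/esym/octahedronC.
  by rewrite -uv crossC; ring.
case=> c c4 ->; exists ((1 - i)^-1 *: (v + c *: u)), ((1 - i)^-1 *: (v - c *: u)).
split=> //; last by rewrite octahedron_rot; apply: eq_octahedron; rewrite ?ptZ.
rewrite (_ : cross _ _ = i * (c * cross u v)); last first.
  by rewrite /cross !mxE; field: i2.
by rewrite !exprMn i4 c4 uv !mul1r.
Qed.

(** Adding c u to v does not change [cross u v], and division by 1 - i divides its fourth power -4
    by -4. *)
Lemma mem_octahedron u v x : cross u v ^+ 4 = -4%:R -> x \in octahedron u v ->
  [\/ x = pt u, x = pt v | (pt u, x) \in cross_orbital 1].
Proof.
move=> uv /octahedronP[->|->|[c c4 ->]]; [by constructor 1 | by constructor 2|].
constructor 3; rewrite mem_cross_orbital crossZr crossDr crossZr crossvv mulr0 addr0.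
by rewrite exprMn exprVn one_minus_i4 uv mulVf ?four_neq0.
Qed.
(** Equal points have [cross] 0, so distinctness is read off from [cross]; for parameters c and d it
    is a nonzero multiple of c - d. *)
Lemma card_octahedron u v : cross u v != 0 -> #|octahedron u v| = 6%N.
Proof.
move=> uv; have k0 : (1 - i)^-1 != 0 by rewrite invr_eq0 i1.
pose w c := (1 - i)^-1 *: (v + c *: u).
have vNw : pt v \notin [set pt (w c) | c in [set c | c ^+ 4 == 1]].
  apply/imsetP => -[c]; rewrite inE => /eqP c4 /pt_cross_eq0 /eqP.
  rewrite crossZr crossDr crossZr crossvv add0r !mulf_eq0 (negPf k0) crossC oppr_eq0.
  by rewrite (negPf uv) orbF; apply/negP/pow4_neq0.
have uNw : pt u \notin [set pt (w c) | c in [set c | c ^+ 4 == 1]].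
  apply/imsetP => -[c]; rewrite inE => /eqP c4 /pt_cross_eq0 /eqP.
  by rewrite crossZr crossDr crossZr crossvv mulr0 addr0 mulf_eq0 (negPf k0) (negPf uv).
have uNv : pt u != pt v by apply: contraNneq uv => /pt_cross_eq0 ->.
have w_inj : {in [set c | c ^+ 4 == 1] &, injective (fun c => pt (w c))}.
  move=> c d; rewrite !inE => /eqP c4 /eqP d4 /pt_cross_eq0 /eqP.
  rewrite crossZl crossZr (_ : cross _ _ = (c - d) * cross u v); last first.
    by rewrite /cross !mxE; ring.
  by rewrite !mulf_eq0 (negPf k0) (negPf uv) orbF subr_eq0 => /eqP.
rewrite !cardsU1 (card_in_imset w_inj) card_pow4_eq1 in_setU1 negb_or.
by rewrite uNv vNw uNw.
Qed.

(** * Blocks are octahedra *)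

(** In T the antipode of (1, 0) is (1, 1-i); the parameters 1, i, -1, -i give (1+i, 1), (i, 1), (0,
    1), (1, 1). *)
Lemma base_blockE : base_block iu = octahedron (vec2 1 0) (vec2 1 (1 - i)).
Proof.
pose w c := (1 - i)^-1 *: (vec2 1 (1 - i) + c *: vec2 1 0) : 'cV[F]_2.
have w0 : w (i ^+ 0) = vec2 (1 + i) 1.
  by apply: col2P; rewrite !mxE /=; field: i2.
have w1 : w (i ^+ 1) = vec2 i 1.
  by apply: col2P; rewrite !mxE /=; field: i2.
have w2 : w (i ^+ 2) = vec2 0 1.
  by apply: col2P; rewrite !mxE /=; field: i2.
have w3 : w (i ^+ 3) = vec2 1 1.
  by apply: col2P; rewrite !mxE /=; field: i2.
have in_w k : pt (w (i ^+ k)) \in octahedron (vec2 1 0) (vec2 1 (1 - i)).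
  apply/octahedronP; constructor 3; exists (i ^+ k); last by [].
  by rewrite exprAC i4 expr1n.
have inB x : (x \in base_block iu) =
    [|| x == pt (vec2 1 0), x == pt (w (i ^+ 2)), x == pt (w (i ^+ 3)),
        x == pt (w (i ^+ 0)), x == pt (w (i ^+ 1)) | x == pt (vec2 1 (1 - i))].
  by rewrite w0 w1 w2 w3 /base_block !inE -!orbA.
apply/eqP; rewrite eqEsubset; apply/andP; split; apply/subsetP=> x.
  by rewrite inB; case/or4P => [||| /or3P[]] /eqP->;
    rewrite ?octahedron_fst ?octahedron_snd ?in_w.
rewrite inB => /octahedronP[->|->|[c c4 ->]]; rewrite ?eqxx ?orbT //.
have /pow4_eq1P[k ->] : c ^+ 4 == 1 by rewrite c4.
by rewrite -/(w _); case: k => -[|[|[|[|k]]]] //= _; rewrite eqxx ?orbT.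
Qed.

Lemma psl_act_octahedron h u v :
  [set psl_act (coset (pmI F) h) x | x in octahedron u v]
  = octahedron (GLval h *m u) (GLval h *m v).
Proof.
rewrite /octahedron !imsetU1 !psl_act_pt -imset_comp; congr (_ |: (_ |: _)).
apply: eq_imset => c /=.
by rewrite psl_act_pt -scalemxAr mulmxDr -scalemxAr.
Qed.

(** The named axis of T has determinant 1 - i, with fourth power -4. Any other pair with this fourth
    power can be rescaled to determinant 1 - i and is then an image of that axis under SL(2,q). *)
Lemma blocksP A :
  reflect (exists u v, cross u v ^+ 4 = -4%:R /\ A = octahedron u v) (A \in blocks iu).
Proof.
have e0 : cross (vec2 1 0) (vec2 1 (1 - i)) = 1 - i by rewrite /cross !mxE /=; ring.
apply: (iffP imsetP) => [[_ /PSL2P[h SLh ->] ->]|[u [v [uv ->]]]].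
  rewrite base_blockE psl_act_octahedron.
  exists (GLval h *m vec2 1 0), (GLval h *m vec2 1 (1 - i)); split=> //.
  by move: SLh; rewrite inE cross_mulmx e0 => /eqP ->; rewrite mul1r one_minus_i4.
have uv0 : cross u v != 0.
  by apply: contraNneq four_neq0 => E; rewrite -uv E expr0n.
pose c := (1 - i) / cross u v.
have c4 : c ^+ 4 = 1 by rewrite expr_div_n uv one_minus_i4 divff ?four_neq0.
have [||h SLh [hu hv]] := @SL2_trans _ (vec2 1 0) (vec2 1 (1 - i)) u (c *: v).
- by rewrite e0 i1.
- by rewrite crossZr e0 divfK.
exists (coset (pmI F) h); first by apply/PSL2P; exists h.
by rewrite base_blockE psl_act_octahedron hu hv; apply: eq_octahedron; rewrite ?ptZ.
Qed.

(* The antipode of [pt u] in its octahedron is its only point in cross_orbital (-4)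
   relation with [pt u]. *)
Lemma octahedron_inj u v v' : cross u v' ^+ 4 = -4%:R -> cross u v ^+ 4 = -4%:R ->
  octahedron u v = octahedron u v' -> pt v = pt v'.
Proof.
move=> uv' uv E; have : pt v \in octahedron u v' by rewrite -E octahedron_snd.
case/(mem_octahedron uv') => // [/esym/pt_cross_eq0 e0|].
  by move/eqP: uv; rewrite e0 expr0n eq_sym (negPf four_neq0).
by rewrite mem_cross_orbital uv eq_sym (negPf one_neq_m4).
Qed.

Lemma block_at_point A u : A \in blocks iu -> pt u \in A ->
  exists2 v, cross u v ^+ 4 = -4%:R & A = octahedron u v.
Proof.
case/blocksP=> u1 [v1 [uv1 ->]] /(octahedron_at_fst uv1)[u2 [v2 [Eu uv2 ->]]].
exists v2; first by rewrite -uv2; apply: pt_cross4.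
exact: eq_octahedron.
Qed.

Lemma mem_blocks u v : cross u v ^+ 4 = -4%:R -> octahedron u v \in blocks iu.
Proof. by move=> uv; apply/blocksP; exists u, v. Qed.

Lemma card_block A : A \in blocks iu -> #|A| = 6%N.
Proof.
case/blocksP=> u [v [uv ->]]; apply: card_octahedron.
by apply: contraNneq four_neq0 => E; rewrite -uv E expr0n.
Qed.

Lemma block_sub A : A \in blocks iu -> A \subset points iu.
Proof.
case/blocksP=> u [v [uv ->]].
have uv0 : cross u v != 0 by apply: contraNneq four_neq0 => E; rewrite -uv E expr0n.
have k0 : (1 - i)^-1 != 0 by rewrite invr_eq0 i1.
apply/subsetP=> x /octahedronP[->|->|[c c4 ->]]; rewrite mem_points.
- exact: cross_neq0l uv0.
- exact: cross_neq0r uv0.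
apply: (@cross_neq0r _ u).
by rewrite crossZr crossDr crossZr crossvv mulr0 addr0 mulf_neq0.
Qed.

(** * Counting blocks through one and two points *)

(** A fourth root of unity scales the antipode of u so that its determinant with u is exactly 1 - i.
    Such vectors form the affine line v0 + t u, with one t for each block. *)
Lemma card_blocks_at x : x \in points iu -> #|[set A in blocks iu | x \in A]| = #|F|.
Proof.
case/pointsP=> u u0 ->; have [v0 uv0] := cross_solve (1 - i) u0.
pose f t := octahedron u (v0 + t *: u).
have uvt t : cross u (v0 + t *: u) = 1 - i.
  by rewrite crossDr crossZr crossvv mulr0 addr0.
have f_inj : injective f.
  move=> t t' /octahedron_inj; rewrite !uvt one_minus_i4 => /(_ erefl erefl).
  move/pt_cross_eq0; rewrite (_ : cross _ _ = (t - t') * cross u v0); last first.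
    by rewrite /cross !mxE; ring.
  by move/eqP; rewrite uv0 mulf_eq0 (negPf i1) orbF subr_eq0 => /eqP.
rewrite -[RHS](card_imset _ f_inj); apply: eq_card => A.
rewrite inE; apply/andP/imsetP => [[BA Au]|[t _ ->]]; last first.
  by rewrite octahedron_fst mem_blocks // uvt one_minus_i4.
have [v uv ->] := block_at_point BA Au.
have cr0 : cross u v != 0 by apply: contraNneq four_neq0 => E; rewrite -uv E expr0n.
pose c := (1 - i) / cross u v.
have c4 : c ^+ 4 = 1 by rewrite expr_div_n uv one_minus_i4 divff ?four_neq0.
have [|t Et] := @cross_eq0_colinear _ u (c *: v - v0) u0.
  rewrite (_ : cross _ _ = c * cross u v - cross u v0); last first.
    by rewrite /cross !mxE; ring.
  by rewrite divfK // uv0 subrr.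
exists t => //; apply: eq_octahedron => //.
by rewrite -Et addrC subrK ptZ.
Qed.

Lemma card_blocks_at2_antipodal u v : cross u v ^+ 4 = -4%:R ->
  #|[set A in blocks iu | (pt u \in A) && (pt v \in A)]| = 1%N.
Proof.
move=> uv; apply/eqP/cards1P; exists (octahedron u v).
apply/setP=> A; rewrite !inE; apply/and3P/eqP => [[BA Au Av]|->]; last first.
  by rewrite mem_blocks // octahedron_fst octahedron_snd.
have [v' uv' EA] := block_at_point BA Au; rewrite EA; apply: eq_octahedron => //.
move: Av; rewrite EA => /(mem_octahedron uv')[/pt_cross_eq0 e0|->//|].
  by move/eqP: uv; rewrite crossC e0 oppr0 expr0n eq_sym (negPf four_neq0).
by rewrite mem_cross_orbital uv eq_sym (negPf one_neq_m4).
Qed.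

(** Solving v = (v' + c u) / (1 - i) for the antipode v' of u gives one block for each fourth root
    of unity c. *)
Lemma card_blocks_at2_adjacent u v : cross u v ^+ 4 = 1 ->
  #|[set A in blocks iu | (pt u \in A) && (pt v \in A)]| = 4%N.
Proof.
move=> uv; have uv0 := pow4_neq0 uv.
pose w c := (1 - i) *: v - c *: u; pose f c := octahedron u (w c).
have uw c : cross u (w c) ^+ 4 = -4%:R.
  rewrite (_ : cross u (w c) = (1 - i) * cross u v); last first.
    by rewrite /cross !mxE; ring.
  by rewrite exprMn uv one_minus_i4 mulr1.
have f_inj : injective f.
  move=> c d /(octahedron_inj (uw d) (uw c)) /pt_cross_eq0 /eqP.
  rewrite (_ : cross _ _ = (d - c) * ((1 - i) * cross u v)); last first.
    by rewrite /cross !mxE; ring.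
  by rewrite !mulf_eq0 (negPf uv0) (negPf i1) !orbF subr_eq0 => /eqP.
rewrite -[RHS]card_pow4_eq1 -[RHS](card_imset _ f_inj); apply: eq_card => A.
rewrite inE; apply/and3P/imsetP => [[BA Au Av]|[c]]; last first.
  rewrite inE => /eqP c4 ->; split; rewrite ?mem_blocks ?octahedron_fst //.
  apply/octahedronP; constructor 3; exists c => //.
  by rewrite /w subrK scalerA mulVf ?scale1r ?i1.
have [v' uv' EA] := block_at_point BA Au; rewrite EA.
move: Av; rewrite EA => /octahedronP[/pt_cross_eq0 e0|E|].
- by move: uv0; rewrite crossC e0 oppr0 eqxx.
- have := pt_cross4 (erefl (pt u)) E; rewrite uv uv' => e.
  by case/eqP: one_neq_m4.
case=> c c4 /eqP/pt_eqP[d d4 Ev'].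
have -> : v' = (1 - i) *: (d *: v) - c *: u.
  by rewrite -Ev' scalerA divff ?i1 // scale1r addrK.
(* Division by the root d turns d v into v and c into c / d. *)
exists (c / d); first by rewrite inE expr_div_n c4 d4 divr1.
apply: eq_octahedron; first by [].
rewrite -[RHS](ptZ _ d4); congr pt.
by apply: col2P; rewrite !mxE; field; rewrite pow4_neq0.
Qed.

(** This gives the value 0 for all relations other than the identity and the two named here. *)
Lemma block_pair_orbital A x y : A \in blocks iu -> x \in A -> y \in A ->
  [\/ x = y, (x, y) \in cross_orbital (-4%:R) | (x, y) \in cross_orbital 1].
Proof.
move=> BA Ax Ay; have /pointsP[u u0 Ex] := subsetP (block_sub BA) _ Ax.
move: Ax; rewrite Ex => /(block_at_point BA)[v uv EA].
move: Ay; rewrite EA => /(mem_octahedron uv)[->|->|Ey].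
- by constructor 1.
- by constructor 2; rewrite mem_cross_orbital uv.
by constructor 3.
Qed.

(** Double counting of incidences: q blocks on each point, six points on each block. *)
Lemma card_points_blocks : (#|points iu| * #|F| = #|blocks iu| * 6)%N.
Proof.
transitivity (\sum_(x in points iu) \sum_(A in blocks iu) (x \in A))%N.
  rewrite -sum_nat_const; apply: eq_bigr => x /card_blocks_at <-.
  rewrite -sum1_card big_mkcond [RHS]big_mkcond /=.
  by apply: eq_bigr => A _; rewrite inE; case: (A \in _); case: (x \in A).
rewrite exchange_big /= -sum_nat_const; apply: eq_bigr => A BA.
rewrite -(card_block BA) -sum1_card big_mkcond [RHS]big_mkcond /=.
apply: eq_bigr => x _; case: ifP => [_|/negP Px]; first by case: (x \in A).
by case: ifP => // Ax; case: Px; apply: subsetP Ax; apply: block_sub.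
Qed.

(** * Numbering the relations *)

Theorem psl2_gpbibd m : (m * 2 + 3 = #|F|)%N ->
  exists R : 'I_m.+1 -> {set {set 'cV[F]_2} * {set 'cV[F]_2}},
    [set R j | j : 'I_m.+1] = schurian_relations (@psl_act F) (PSL2 F) (points iu)
    /\ GPBIBD (points iu) (blocks iu) R #|points iu| #|blocks iu| 6 #|F|
         (fun j => if j == 1 then 4 else if j == 2 then 1 else 0)%N.
Proof.
move=> card_F.
pose S := schurian_relations (@psl_act F) (PSL2 F) (points iu).
have cardS : #|S| = m.+1.
  have := card_schurian_relations; rewrite -/S -card_F; lia.
pose C s := cross_orbital s; pose D := [set (x, x) | x in points iu].
have [fp1 fp4] : 1 \in fourth_powers /\ -4%:R \in fourth_powers.
  split; apply/fourth_powersP.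
    by exists 1; rewrite ?oner_eq0 ?expr1n.
  by exists (1 - i); rewrite ?one_minus_i4 ?one_minus_i_neq0.
have SD : D \in S.
  rewrite /S schurian_relationsE // /D -line_orbital1 // inE; apply/orP; right.
  exact: imset_f.
have SC s : s \in fourth_powers -> C s \in S.
  by move=> fs; rewrite /S schurian_relationsE // inE imset_f.
have C_neqD s : s \in fourth_powers -> C s != D.
  by move=> fs; rewrite /D -line_orbital1 // cross_line_orbital_neq.
have C14 : C 1 != C (-4%:R).
  apply/eqP=> /(cross_orbital_inj fp1) E.
  by case/eqP: one_neq_m4.
(* Positions in this list number the relations: the identity, then edges (4 blocks), then axes (1
   block), then the rest. *)
pose s := [:: D; C 1; C (-4%:R)] ++ enum (S :\: [set D; C 1; C (-4%:R)]).
have s_uniq : uniq s.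
  rewrite cat_uniq enum_uniq /= !inE !negb_or C14 ![D == _]eq_sym !C_neqD //= andbT.
  apply/hasPn => r; rewrite mem_enum !inE -orbA.
  by case/andP.
have mem_s R : (R \in s) = (R \in S).
  rewrite mem_cat mem_enum !inE.
  case: eqP => [->|_] //=; case: eqP => [->|_] /=; first by rewrite SC.
  by case: eqP => [->|_] //=; rewrite SC.
have size_s : size s = m.+1.
  by rewrite -(card_uniqP s_uniq) (eq_card mem_s).
(* The list has length m + 1, so the default [set0] is never returned. *)
pose R (j : 'I_m.+1) := nth set0 s j.
have R_inj : injective R.
  move=> j l /eqP; rewrite nth_uniq ?size_s // => /eqP; exact: val_inj.
have RE : [set R j | j : 'I_m.+1] = S.
  apply/setP=> r; rewrite -mem_s; apply/imsetP/idP => [[j _ ->]|].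
    by rewrite mem_nth ?size_s.
  by case/(nthP set0) => j; rewrite size_s => ltj <-; exists (Ordinal ltj).
have scheme : association_scheme (points iu) R.
  apply: (@schurian_scheme _ _ (@psl_act F) (SL2_group F / pmI_group F)%G) => //.
  - by move=> g x; apply: psl_act_closed.
  - by move=> x; apply: psl_act1.
  - by move=> g h x; apply: psl_actM.
exists R; split=> //.
split=> //.
- by move=> A; apply: block_sub.
- by move=> A; apply: card_block.
- by move=> x; apply: card_blocks_at.
have R_mem j xy : xy \in R j -> exists u v, xy = (ptclass iu u, ptclass iu v).
  case: xy => x y Rxy; have : (x, y) \in setX (points iu) (points iu).
    rewrite -(cover_partition (as_partition scheme)).
    by apply/bigcupP; exists (R j); rewrite ?imset_f.
  by case/setXP=> /pointsP[u _ ->] /pointsP[v _ ->]; exists u, v.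
have R_uniq j xy r : xy \in R j -> r \in S -> xy \in r -> R j = r.
  have R_im l : R l \in [set R j | j : 'I_m.+1] by apply: imset_f.
  rewrite -RE => Rxy /imsetP[l _ ->] Rlxy; apply/eqP; apply: contraT => neq.
  have /trivIsetP tI := partition_trivIset (as_partition scheme).
  by have /pred0P/(_ xy) := tI _ _ (R_im j) (R_im l) neq; rewrite /= Rxy Rlxy.
move=> j j_gt0 x y Rxy; have [u [v [Ex Ey]]] := R_mem _ _ Rxy.
have [j1|j_neq1] := eqVneq (val j) 1%N.
  move: Rxy; rewrite {1}/R j1 /= Ex Ey mem_cross_orbital // => /eqP.
  exact: card_blocks_at2_adjacent.
have [j2|j_neq2] := eqVneq (val j) 2.
  move: Rxy; rewrite {1}/R j2 /= Ex Ey mem_cross_orbital // => /eqP.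
  exact: card_blocks_at2_antipodal.
apply: eq_card0 => A; rewrite inE; apply/negP => /and3P[BA Ax Ay].
(* The relations are disjoint, so any relation containing (x, y) stands at position j. *)
have nth_s k r : r = nth set0 s k -> (k < m.+1)%N -> r \in S -> (x, y) \in r -> val j = k.
  move=> -> ltk Sr /(R_uniq j _ _ Rxy Sr) /eqP.
  by rewrite nth_uniq ?size_s // => /eqP.
have m_ge2 : (2 < m.+1)%N by rewrite -size_s.
have Px : x \in points iu by apply: subsetP Ax; apply: block_sub.
(* A common block would put (x, y) in one of the first three relations, but j is none of 0, 1, 2. *)
case: (block_pair_orbital BA Ax Ay) => [xy|Cxy|Cxy].
- suff j0 : val j = 0%N by move: j_gt0; rewrite -[X in (0 < X)%N]/(val j) j0.
  by apply: (nth_s 0%N D) => //; apply/imsetP; exists x; rewrite ?xy -?xy.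
- by case/eqP: j_neq2; apply: (nth_s 2 (C (-4%:R))) => //; apply: SC.
by case/eqP: j_neq1; apply: (nth_s 1%N (C 1)) => //; [apply: ltnW | apply: SC].
Qed.

End Design.

(** * The parameters in terms of q *)

Theorem theorem2p8 (p alpha q : nat) (F : finFieldType) (w : {unit F})
    (p_prime : prime p) (alpha_gt0 : (0 < alpha)%N) (q_def : q = (p ^ alpha)%N)
    (q_mod4 : q = 1 %[mod 4]) (p_neq5 : p <> 5)
    (card_F : #|F| = q) (w_gen : <[w]>%g = [set: {unit F}]) :
  let i := (w ^+ ((q - 1) %/ 4))%g in
  let m := ((q - 3) %/ 2)%N in
  exists R : 'I_m.+1 -> {set {set 'cV[F]_2} * {set 'cV[F]_2}},
    [set R j | j : 'I_m.+1] = schurian_relations (@psl_act F) (PSL2 F) (points i)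
    /\ GPBIBD (points i) (blocks i) R
         ((q ^ 2 - 1) %/ 4) ((q * (q ^ 2 - 1)) %/ 24) 6 q
         (fun j => if j == 1 then 4 else if j == 2 then 1 else 0).
Proof.
move=> i m.
have q_gt1 : (1 < q)%N by rewrite -card_F card_finNzRing_gt1.
have dvd4 : (4 %| q - 1)%N by rewrite -eqn_mod_dvd 1?ltnW // q_mod4.
have ord_w : #[w]%g = (q - 1)%N by rewrite orderE w_gen card_finField_unit card_F subn1.
have ord_i : #[i]%g = 4%N.
  rewrite orderXdiv ord_w; first by rewrite divnA ?mulKn //; lia.
  by apply/dvdnP; exists 4%N; rewrite mulnC divnK.
(* i^2 is a square root of 1 and differs from 1 because i has order 4. *)
have i2 : (val i ^+ 2 = -1)%R.
  have /eqP : ((val i ^+ 2) ^+ 2 = 1)%R.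
    by rewrite -exprM -[(2 * 2)%N]/4%N -ord_i -FinRing.val_unitX expg_order.
  rewrite sqrf_eq1 => /orP[/eqP i2|/eqP //].
  have : (i ^+ 2 == 1)%g by apply/eqP/val_inj; rewrite FinRing.val_unitX.
  by rewrite -order_dvdn ord_i.
(* If 2 = 0, then i^2 = -1 = 1, against the order of i. *)
have two_neq0 : (2%:R != 0 :> F)%R.
  apply: contraTneq isT => two0.
  have N11 : (-1 = 1 :> F)%R by apply/eqP; rewrite -subr_eq0 -opprD oppr_eq0; apply/eqP.
  have : (i ^+ 2 == 1)%g by apply/eqP/val_inj; rewrite FinRing.val_unitX i2.
  by rewrite -order_dvdn ord_i.
have five_neq0 : (5%:R != 0 :> F)%R.
  have pF : p \in [pchar F]%R by apply: (@card_finPcharP _ _ alpha); rewrite ?card_F.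
  rewrite -(dvdn_pcharf pF) (@dvdn_prime2 p 5) //; exact/eqP.
(* From q > 1 and q = 1 mod 4, q is odd and at least 5: the subtraction is not truncated and the
   division by 2 is exact. *)
have m_def : (m * 2 + 3 = #|F|)%N by rewrite card_F /m; lia.
have [R [RE design]] := psl2_gpbibd i2 two_neq0 five_neq0 m_def.
have v_def : #|points i| = (q ^ 2 - 1) %/ 4.
  by rewrite -card_F -(card_points i2 two_neq0) mulnK.
have b_def : #|blocks i| = (q * (q ^ 2 - 1)) %/ 24.
  rewrite -card_F -(card_points i2 two_neq0) mulnA [_ * #|points _|]mulnC.
  by rewrite (card_points_blocks i2 two_neq0 five_neq0) -mulnA mulnK.
by exists R; split; rewrite // -v_def -b_def -card_F.
Qed.
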